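(* Consider the one-dimensional periodic atomistic system with $N$ atoms per period, interaction range $n$, interatomic potential $\varphi$ and scale $\epsilon>0$ described in the context. Let the external force be zero, $f_i=0$ for all $i$, so that $\Pi(\boldsymbol{u})=E_{\rm tot}(\boldsymbol{u})$. Let $u^0_i=\epsilon z i$ $(-\infty<i<\infty)$ be a uniform lattice, where $z>0$ is such that $\epsilon z N=1$ (so that $u^0_{i+N}=u^0_i+1$). Let $1\le i_1<i_2<\dots<i_K\le N$ be the indices of the nodal atoms, with $K\ge 1$. Then $\boldsymbol{u}^{0,{\rm QC}}=[u^0_{i_k}]_{k=1}^K$ is a solution of the quasicontinuum projection (QCP) method, i.e. $$\left.\frac{\partial \Pi^{\rm QCP}}{\partial u_{i_k}}\right|_{\boldsymbol{u}^{\rm QC}=\boldsymbol{u}^{0,{\rm QC}}}=0\qquad(1\le k\le K).$$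
   Context: Atomistic model. Atom positions are real numbers $u_i$, $-\infty<i<\infty$, satisfying $u_{i+N}=u_i+1$ for all $i$; the degrees of freedom are $\boldsymbol{u}=(u_1,\dots,u_N)$, and all other positions are determined by this periodicity. The potential $\varphi$ is a differentiable function on $(0,\infty)$, extended to negative arguments by $\varphi(-r)=\varphi(r)$, and it vanishes for sufficiently large arguments, so that each atom interacts with at most $n$ neighbours on each side. The interaction energy per period is $$E_{\rm tot}(\boldsymbol{u})=\frac{\epsilon}{2}\sum_{i=1}^{N}\ \sum_{\substack{j=i-n\\ j\ne i}}^{i+n}\varphi\left(\frac{u_i-u_j}{\epsilon}\right)$$ (defined wherever the arguments of $\varphi$ are nonzero). The external energy is $E_{\rm ext}(\boldsymbol{u})=-\epsilon\sum_{i=1}^N f_iu_i$, and the total potential energy is $\Pi=E_{\rm tot}+E_{\rm ext}$. QCP method. Given nodal indices $1\le i_1<\dots<i_K\le N$, put $i_0=i_K-N$ and, by periodicity, $u_{i_0}=u_{i_K}-1$. The QC unknowns are $\boldsymbol{u}^{\rm QC}=[u_{i_1},\dots,u_{i_K}]$. The reconstruction $\boldsymbol{u}=U^{\rm QC}\boldsymbol{u}^{\rm QC}$ keeps the nodal positions and determines all other positions by linear interpolation, $$u_i=\frac{i_k-i}{i_k-i_{k-1}}\,u_{i_{k-1}}+\frac{i-i_{k-1}}{i_k-i_{k-1}}\,u_{i_k}\qquad (i_{k-1}<i<i_k),\quad k=1,\dots,K,$$ together with the periodic extension $u_{i+N}=u_i+1$. The QCP energy is $\Pi^{\rm QCP}(\boldsymbol{u}^{\rm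 QC})=\Pi(U^{\rm QC}\boldsymbol{u}^{\rm QC})$, a function of the $K$ nodal positions, and a QCP solution is a critical point of $\Pi^{\rm QCP}$. *)

(* Defs.v *)
From HB Require Import structures.
From mathcomp Require Import all_boot all_order all_algebra.
From mathcomp Require Import all_classical all_reals all_analysis.
Set Implicit Arguments.
Unset Strict Implicit.
Unset Printing Implicit Defensive.
Import Order.TTheory GRing.Theory Num.Theory.
Import numFieldNormedType.Exports.
Local Open Scope ring_scope.

(* A configuration is the bi-infinite family [u : int -> R] of all atom
   positions.  The potential is a total function [phi : R -> R]; its value at 0
   has no meaning, just as the energy has no meaning when two interacting atoms
   coincide. *)

Definition Etot (R : realType) (eps : R) (phi : R -> R) (n N : nat)
    (u : int -> R) : R :=
  eps / 2 *
  \sum_(1 <= i < N.+1)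
    \sum_(j <- [seq i%:Z - n%:Z + d%:Z | d <- iota 0 (2 * n)%N.+1] | j != i%:Z)
      phi ((u i%:Z - u j) / eps).

Definition Eext (R : realType) (eps : R) (f : int -> R) (N : nat)
    (u : int -> R) : R :=
  - eps * \sum_(1 <= i < N.+1) f i%:Z * u i%:Z.

Definition Pi_energy (R : realType) (eps : R) (phi : R -> R) (f : int -> R)
    (n N : nat) (u : int -> R) : R :=
  Etot eps phi n N u + Eext eps f N u.

(* There are K = m.+1 >= 1 nodal atoms, numbered from 0: [nod k] and [v 0 k]
   are the index i_{k+1} and the position u_{i_{k+1}} of the usual 1-based
   numbering. *)
Section Reconstruction.
Variables (R : realType) (N m : nat) (nod : 'I_m.+1 -> nat).

(* i_0 = i_K - N, the last nodal atom shifted back by one period *)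
Definition node0 : int := (nod ord_max)%:Z - N%:Z.

(* Index and position of the left neighbour of node k; the left neighbour of
   the first node is i_0, with u_{i_0} = u_{i_K} - 1. *)
Definition prev_node (k : 'I_m.+1) : int :=
  if k == ord0 then node0 else (nod (ord_pred k))%:Z.

Definition prev_pos (v : 'rV[R]_m.+1) (k : 'I_m.+1) : R :=
  if k == ord0 then v 0 ord_max - 1 else v 0 (ord_pred k).

Definition interpolate (v : 'rV[R]_m.+1) (k : 'I_m.+1) (i : int) : R :=
  ((nod k)%:Z - i)%:~R / ((nod k)%:Z - prev_node k)%:~R * prev_pos v k
  + (i - prev_node k)%:~R / ((nod k)%:Z - prev_node k)%:~R * v 0 k.

(* The intervals (i_{k-1}, i_k] partition the period (i_0, i_K]; at i = i_k the
   interpolation formula returns the nodal position itself. *)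
Definition UQC_period (v : 'rV[R]_m.+1) (i : int) : R :=
  if [pick k : 'I_m.+1 | prev_node k < i <= (nod k)%:Z] is Some k
  then interpolate v k i else 0.

(* q is the unique integer with i_0 < i - q N <= i_K. *)
Definition UQC (v : 'rV[R]_m.+1) (i : int) : R :=
  let q := ((i - node0 - 1) %/ N%:Z)%Z in UQC_period v (i - q * N%:Z) + q%:~R.

End Reconstruction.

Definition Pi_QCP (R : realType) (eps : R) (phi : R -> R) (f : int -> R)
    (n N m : nat) (nod : 'I_m.+1 -> nat) (v : 'rV[R]_m.+1) : R :=
  Pi_energy eps phi f n N (UQC N nod v).

(* Every partial derivative of the QCP energy exists at v and is zero. *)
Definition QCP_solution (R : realType) (eps : R) (phi : R -> R) (f : int -> R)
    (n N m : nat) (nod : 'I_m.+1 -> nat) (v : 'rV[R]_m.+1) : Prop :=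
  forall k : 'I_m.+1, is_derive v (delta_mx 0 k) (Pi_QCP eps phi f n N nod) 0.

Definition uniform_lattice (R : realType) (eps z : R) (i : int) : R :=
  eps * z * i%:~R.

(* Main.v *)
Require Import Defs.
From HB Require Import structures.
From mathcomp Require Import all_boot all_order all_algebra.
From mathcomp Require Import all_classical all_reals all_analysis.
From mathcomp Require Import zify ring.
Set Implicit Arguments.
Unset Strict Implicit.
Unset Printing Implicit Defensive.
Import Order.TTheory GRing.Theory Num.Theory.
Import numFieldNormedType.Exports.
Local Open Scope ring_scope.

(** The uniform lattice is an equilibrium of the full atomistic model, and the
    reconstruction meets that equilibrium along an admissible direction, so the
    constrained energy is stationary there as well.

    More precisely, moving one nodal position by [h] changes the reconstructed
    configuration affinely in [h] ([UQC_affine]): atom [i] is displaced by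
    [h * w i].  Since every reconstruction gains exactly 1 over a period
    ([UQC_periodic]), the displacement [w] is [N]-periodic.  Linear
    interpolation reproduces linear data, so the configuration at [h = 0] is
    the uniform lattice itself ([UQC_uniform]).

    It remains to differentiate the energy of the uniform lattice perturbed by
    [h * w] ([uniform_lattice_equilibrium]).  In a uniform lattice the force
    between two atoms depends only on their index difference [d], so for each
    [d] the derivative contributes a constant [phi'(- z d)] times the sum over
    one period of [w i - w (i + d)].  A sum over a period does not change when
    the index is shifted ([sum_period_shift]), hence each of these sums
    vanishes. *)

(** Shifting by one drops the term at 1 and adds the term at [N + 1], which is
    equal to it. *)
Lemma sum_period_succ (V : zmodType) (N : nat) (g : int -> V) :
  (forall i, g (i + N%:Z) = g i) ->
  \sum_(1 <= i < N.+1) g (i%:Z + 1) = \sum_(1 <= i < N.+1) g i%:Z.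
Proof.
move=> gN; apply/eqP; rewrite -subr_eq0 -sumrB.
under eq_bigr => i _ do rewrite -(PoszD i 1) addn1.
by rewrite (telescope_sumr (fun i => g i%:Z)) // -add1n PoszD gN subrr.
Qed.

Lemma sum_period_shift (V : zmodType) (N : nat) (g : int -> V) (c : int) :
  (forall i, g (i + N%:Z) = g i) ->
  \sum_(1 <= i < N.+1) g (i%:Z + c) = \sum_(1 <= i < N.+1) g i%:Z.
Proof.
move=> gN; elim/int_rect: c => [|c IH|c IH].
- by under eq_bigr => i _ do rewrite addr0.
- rewrite -IH -(@sum_period_succ _ _ (fun i => g (i + c%:Z))).
    by apply: eq_bigr => i _; congr g; lia.
  by move=> i; rewrite -[RHS]gN; congr g; lia.
- rewrite -IH -(@sum_period_succ _ _ (fun i => g (i - c.+1%:Z))).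
    by apply: eq_bigr => i _; congr g; lia.
  by move=> i; rewrite -[RHS]gN; congr g; lia.
Qed.

(** Pairs with [i < j] have negative separation, and there the derivative of
    the potential is only available by reflection. *)
Lemma even_derivable (R : realType) (phi : R -> R) :
  (forall r, 0 < r -> phi (- r) = phi r) ->
  (forall r, 0 < r -> derivable phi r 1) ->
  forall r, r != 0 -> derivable phi r 1.
Proof.
move=> phi_even phi_der r; case: (ltgtP r 0) => // [r0|r0] _; last exact: phi_der.
have Hc : is_derive r 1 (phi \o -%R) ('D_1 phi (- r) * -1).
  apply: is_derive1_comp.
  by apply/derivableP/phi_der; rewrite oppr_gt0.
apply: (near_eq_derivable (f := phi \o -%R)); last by case: Hc.
near=> x; rewrite /= -(phi_even (- x)) ?opprK // oppr_gt0.
by near: x; exact: lt_nbhsl.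
Unshelve. all: by end_near. Qed.

(** Reduces a directional derivative to one real variable, where the chain rule
    of real functions applies. *)
Lemma is_derive_line (R : realType) (V W : normedModType R) (F : V -> W)
    (x e : V) (l : W) :
  is_derive (0 : R) 1 (fun h : R => F (h *: e + x)) l -> is_derive x e F l.
Proof.
move=> [der <-]; split; first exact/derivable1P.
set g := fun h : R => F (h *: e + x).
have quotientE : (fun h : R => h^-1 *: ((F \o shift x) (h *: e) - F x)) =
    (fun h => h^-1 *: ((g \o shift 0) (h *: (1 : R)) - g 0)).
  apply/funext => h.
  by rewrite /g /= scale0r add0r addr0 [h *: (1 : R)]mulr1.
by rewrite /derive quotientE.
Qed.

Lemma is_derive_big (R : realType) (I : Type) (s : seq I) (P : pred I)
    (h : I -> R -> R) (dh : I -> R) (x : R) :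
  (forall i, P i -> is_derive x 1 (h i) (dh i)) ->
  is_derive x 1 (fun t => \sum_(i <- s | P i) h i t) (\sum_(i <- s | P i) dh i).
Proof.
move=> H; rewrite -fct_sumE.
elim/big_ind2 : _ => [|f df g dg Hf Hg|//]; first exact: is_derive_cst.
exact: is_deriveD.
Qed.

(** For a fixed index difference [d - n], the pair forces in a uniform lattice
    are equal for all [i], so they factor out of the sum over [i]; what is left
    is the sum of a periodic function minus the sum of its shift. *)
Lemma uniform_lattice_equilibrium (R : realType) (N n : nat) (eps z : R)
    (phi : R -> R) (w : int -> R) :
  eps != 0 -> z != 0 -> (forall r, r != 0 -> derivable phi r 1) ->
  (forall i, w (i + N%:Z) = w i) ->
  is_derive (0 : R) 1
    (fun h => Etot eps phi n N (fun i => uniform_lattice eps z i + h * w i)) 0.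
Proof.
move=> eps0 z0 dphi wN.
have -> : (fun h => Etot eps phi n N
             (fun i => uniform_lattice eps z i + h * w i)) =
   (fun h => eps / 2 * \sum_(1 <= i < N.+1)
     \sum_(d <- iota 0 (2 * n).+1 | d != n)
       phi (z * (n%:Z - d%:Z)%:~R
            + h * ((w i%:Z - w (i%:Z + (d%:Z - n%:Z))) / eps))).
  apply/funext => h; rewrite /Etot; congr (_ * _); apply: eq_bigr => i _.
  rewrite big_map; apply: eq_big => [d|d _]; first by lia.
  congr phi; rewrite /uniform_lattice.
  have -> : i%:Z - n%:Z + d%:Z = i%:Z + (d%:Z - n%:Z) by lia.
  by rewrite !(intrD, intrB, mulrzBr, intrM, rmorphB) /=; field.
(* The chain rule below yields this expression for the derivative. *)
have forces_cancel : (eps / 2) *: \sum_(1 <= i < N.+1)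
     \sum_(d <- iota 0 (2 * n).+1 | d != n)
       'D_1 phi (z * (n%:Z - d%:Z)%:~R) *
         ((w i%:Z - w (i%:Z + (d%:Z - n%:Z))) / eps) = 0.
  rewrite exchange_big /= big1 ?scaler0 // => d _.
  by rewrite -mulr_sumr -mulr_suml sumrB (sum_period_shift _ wN) subrr mul0r mulr0.
apply: is_derive_eq forces_cancel; apply: is_deriveZ.
apply: is_derive_big => i _; apply: is_derive_big => d dn.
set a := z * _; set b := _ / eps.
have a0 : a != 0 by rewrite mulf_neq0 // intr_eq0; lia.
apply: (@is_derive1_comp _ phi (fun h : R => a + h * b)).
  by rewrite mul0r addr0; apply/derivableP/dphi.
by apply: is_derive_eq; rewrite add0r mul1r scaler0 add0r [_ *: _]mulr1.
Qed.

Section Reconstruction.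
Variables (R : realType) (N m : nat) (nod : 'I_m.+1 -> nat).
Implicit Types (v e : 'rV[R]_m.+1) (i : int).

Lemma interpolate_affine e v (h : R) k i :
  interpolate N nod (h *: e + v) k i =
  interpolate N nod v k i
  + h * (interpolate N nod (e + v) k i - interpolate N nod v k i).
Proof.
by rewrite /interpolate /prev_pos; case: ifP => _; rewrite !mxE; ring.
Qed.

(** The interval that contains [i] and the period offset [q] depend on the nodal
    indices alone, so the only dependence on the nodal positions is through the
    interpolation formula.  The slope is written as the increment at [h = 1]
    because the map is affine, not linear: the left neighbour of the first node
    carries the constant -1, and each period the constant [q]. *)
Lemma UQC_affine e v (h : R) i :
  UQC N nod (h *: e + v) i =
  UQC N nod v i + h * (UQC N nod (e + v) i - UQC N nod v i).
Proof.
rewrite /UQC /UQC_period; case: pickP => [k _|_]; last by ring.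
by rewrite interpolate_affine; ring.
Qed.

Lemma UQC_periodic v i : (0 < N)%N -> UQC N nod v (i + N%:Z) = UQC N nod v i + 1.
Proof.
move=> N0; rewrite /UQC.
have -> : i + N%:Z - node0 N nod - 1 = 1 * N%:Z + (i - node0 N nod - 1) by lia.
rewrite divzMDl; last by lia.
set q := (_ %/ _)%Z.
have -> : i + N%:Z - (1 + q) * N%:Z = i - q * N%:Z by lia.
by rewrite intrD -addrA; congr (_ + _); rewrite addrC.
Qed.

(** Take the first node that is not to the left of [i]; its predecessor is, by
    minimality, or by the lower bound on [i] when that node is the first one.
    Thus [pick] in the reconstruction never falls back to its
    default value on a full period. *)
Lemma node_interval i : node0 N nod < i <= (nod ord_max)%:Z ->
  exists k, prev_node N nod k < i <= (nod k)%:Z.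
Proof.
move=> /andP[i0 iK].
have [k ik kmin] := @arg_minnP _ ord_max (fun k => i <= (nod k)%:Z) val iK.
exists k; rewrite ik andbT /prev_node; case: eqP => [//|/eqP k0].
rewrite ltNge; apply/negP => /kmin /=.
have k0' : (0 < k)%N by rewrite lt0n.
have := ltn_ord k.
case: k k0' {ik kmin k0} => [[|k] /= km] // _ _.
by rewrite modnDr modn_small ?ltnn //; lia.
Qed.

(** Across the period boundary, the position [u_{i_K} - 1] of the left neighbour
    of the first node is the lattice position of index [i_K - N], since [N]
    lattice spacings have total length 1.  So both interpolation endpoints lie
    on the same line, whichever interval is considered. *)
Lemma interpolate_uniform (eps z : R) k i : eps * z * N%:R = 1 ->
  prev_node N nod k < i <= (nod k)%:Z ->
  interpolate N nod (\row_(k < m.+1) uniform_lattice eps z (nod k)%:Z) k i =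
  uniform_lattice eps z i.
Proof.
move=> ezN /andP[pi ik].
have -> : interpolate N nod
   (\row_(k < m.+1) uniform_lattice eps z (nod k)%:Z) k i =
   ((nod k)%:Z - i)%:~R / ((nod k)%:Z - prev_node N nod k)%:~R
     * uniform_lattice eps z (prev_node N nod k)
   + (i - prev_node N nod k)%:~R / ((nod k)%:Z - prev_node N nod k)%:~R
     * uniform_lattice eps z (nod k)%:Z.
  rewrite /interpolate /prev_pos !mxE; congr (_ * _ + _).
  rewrite /prev_node; case: ifP => // _; rewrite /node0 /uniform_lattice.
  by rewrite rmorphB /= mulrBr -[X in _ - X]ezN.
have d0 : ((nod k)%:Z - prev_node N nod k)%:~R != 0 :> R.
  by rewrite intr_eq0; lia.
rewrite /uniform_lattice; move: d0; rewrite !rmorphB /= => d0.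
by field.
Qed.

Lemma UQC_uniform (eps z : R) i : (0 < N)%N -> eps * z * N%:R = 1 ->
  UQC N nod (\row_(k < m.+1) uniform_lattice eps z (nod k)%:Z) i =
  uniform_lattice eps z i.
Proof.
move=> N0 ezN; rewrite /UQC.
set q := (_ %/ _)%Z.
have Hi : node0 N nod < i - q * N%:Z <= (nod ord_max)%:Z.
  have NZ : N%:Z != 0 by lia.
  have := divz_eq (i - node0 N nod - 1) N%:Z.
  have := modz_ge0 (i - node0 N nod - 1) NZ.
  have : ((i - node0 N nod - 1) %% N%:Z)%Z < N%:Z by rewrite ltz_pmod // ltz_nat.
  by rewrite -/q /node0; lia.
rewrite /UQC_period; case: pickP => [k Hk|none].
  rewrite interpolate_uniform // /uniform_lattice rmorphB rmorphM /=.
  by rewrite mulrBr -addrA mulrCA -[N%:~R]/(N%:R) ezN mulr1 addNr addr0.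
by have [k] := node_interval Hi; rewrite none.
Qed.

End Reconstruction.

Theorem theorem1 (R : realType) (N n m : nat) (eps z : R)
    (phi : R -> R) (f : int -> R) (nod : 'I_m.+1 -> nat)
    (eps_gt0 : 0 < eps)
    (phi_even : forall r : R, 0 < r -> phi (- r) = phi r)
    (phi_derivable : forall r : R, 0 < r -> derivable phi r 1)
    (phi_cutoff : exists rc : R, forall r : R, rc < r -> phi r = 0)
    (f_eq0 : forall i : int, f i = 0)
    (z_gt0 : 0 < z)
    (period1 : eps * z * N%:R = 1)
    (nod_range : forall k : 'I_m.+1, (1 <= nod k <= N)%N)
    (nod_incr : forall k l : 'I_m.+1, (k < l)%N -> (nod k < nod l)%N) :
  QCP_solution eps phi f n N nod
    (\row_(k < m.+1) uniform_lattice eps z (nod k)%:Z).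
Proof.
move=> k; set v := \row_k _; set e := delta_mx 0 k.
have N_gt0 : (0 < N)%N by have := nod_range ord0; lia.
pose w i := UQC N nod (e + v) i - UQC N nod v i.
have w_periodic i : w (i + N%:Z) = w i.
  by rewrite /w !UQC_periodic //; ring.
apply: is_derive_line.
have -> : (fun h : R => Pi_QCP eps phi f n N nod (h *: e + v)) =
    (fun h => Etot eps phi n N (fun i => uniform_lattice eps z i + h * w i)).
  apply/funext => h; rewrite /Pi_QCP /Pi_energy /Eext.
  rewrite big1 ?mulr0 ?addr0; last by move=> i _; rewrite f_eq0 mul0r.
  congr Etot; apply/funext => i.
  by rewrite UQC_affine -/(w i) UQC_uniform.
apply: uniform_lattice_equilibrium => //; rewrite ?gt_eqF //.
exact: even_derivable.
Qed.
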